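(* Let $n\ge 1$ and let $(\lambda^{1},\ldots,\lambda^{n})$ be a vector of inputs, with $\lambda^{k}\in\Lambda^{k}=\{1,\ldots,m_{k}\}$, $m_{k}\geq 1$, for $k=1,\ldots,n$. Let $\Phi\subset\Lambda^{1}\times\ldots\times\Lambda^{n}$ be a nonempty set of allowable treatments. For every $\phi\in\Phi$ let $(A_{\phi}^{1},\ldots,A_{\phi}^{n})$ be a vector of jointly distributed random variables. Then $$(A^{1},\ldots,A^{n})\looparrowleft(\lambda^{1},\ldots,\lambda^{n})$$ if and only if there exists a vector of jointly distributed random variables $$H=\left(H_{1}^{1},\ldots,H_{m_{1}}^{1},\ \ldots,\ H_{1}^{k},\ldots,H_{m_{k}}^{k},\ \ldots,\ H_{1}^{n},\ldots,H_{m_{n}}^{n}\right)$$ (one random variable per each value of each input) such that $$(A_{\phi}^{1},\ldots,A_{\phi}^{n})\sim(H_{\lambda^{1}}^{1},\ldots,H_{\lambda^{n}}^{n})$$ for every $\phi=(\lambda^{1},\ldots,\lambda^{n})\in\Phi$.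
   Context: Random variables are understood in the broad sense: a random variable $A$ has a distribution $(S,\Sigma,p)$, where $S$ is an arbitrary nonempty set of values, $\Sigma$ is a sigma-algebra over $S$, and $p$ is a probability measure on $\Sigma$. A vector $(A^1,\ldots,A^n)$ of random variables with value spaces $(S^k,\Sigma^k)$ is jointly distributed if it is itself a random variable with values in $S^1\times\ldots\times S^n$, equipped with the product sigma-algebra $\Sigma^1\otimes\ldots\otimes\Sigma^n$, whose marginals are the distributions of $A^1,\ldots,A^n$; its subvectors then have the corresponding marginal distributions. The symbol $\sim$ means ''has the same distribution as''. For each $k$, the random variables $A^k_\phi$ ($\phi\in\Phi$) share the same value space $(S^k,\Sigma^k)$; only the probability measures depend on $\phi$. For different $\phi$, the vectors $(A_\phi^1,\ldots,A_\phi^n)$ are stochastically unrelated (no joint distribution across different treatments is given), so the data consist of one probability distribution on $S^1\times\ldots\times S^n$ for each $\phi\in\Phi$. Definition (selective influences): $(A^{1},\ldots,A^{n})\looparrowleft(\lambda^{1},\ldots,\lambda^{n})$ means that there exist a random variable $R$ (with an arbitrary distribution) and functions $f_{1},\ldots,f_{n}$ such that $$(A_{\phi}^{1},\ldots,A_{\phi}^{n})\sim\left(f_{1}(\lambda^{1},R),\ldots,f_{n}(\lambda^{n},R)\right)\quad\text{for every }\phi=(\lambda^{1},\ldots,\lambda^{n})\in\Phi .$$ Here $f_k(\lambda,R)$ is required to be a random variable for each $k$ and each $\lambda\in\Lambda^k$, i.e. $f_k(\lambda,\cdot)$ is a measurable function; the right-hand side has the joint distribution induced from the distribution of the single random variable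 $R$. *)

(* Defs.v *)
From HB Require Import structures.
From mathcomp Require Import all_boot all_order all_algebra.
From mathcomp Require Import all_classical all_reals all_analysis.

Set Implicit Arguments.
Unset Strict Implicit.
Unset Printing Implicit Defensive.

Local Open Scope classical_set_scope.
Local Open Scope ring_scope.

Definition cylinders (I : Type) (d : I -> measure_display)
    (S : forall i, measurableType (d i)) : set (set (forall i, S i)) :=
  \bigcup_(i in [set: I])
    preimage_set_system [set: forall i, S i] (fun x => x i) measurable.
Arguments cylinders {I d} S.

(* The product space: the dependent functions [forall i, S i] with the product
   sigma-algebra, i.e. the one generated by the coordinate maps.  A vector of
   jointly distributed random variables, identified with its distribution, is
   a [probability (prod_space S) R]. *)
Definition prod_space (I : Type) (d : I -> measure_display)
    (S : forall i, measurableType (d i)) :=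
  g_sigma_algebraType (cylinders S).

Section vectors.
Context {I : Type} {d : I -> measure_display}
  {S : forall i, measurableType (d i)}.

Definition coordinate (i : I) (x : prod_space S) : S i := x i.

Lemma measurable_coordinate (i : I) :
  measurable_fun [set: prod_space S] (coordinate i).
Proof.
move=> _ B mB; apply: sub_sigma_algebra.
by exists i => //; exists B.
Qed.

HB.instance Definition _ (i : I) :=
  isMeasurableFun.Build _ _ _ _ (coordinate i) (@measurable_coordinate i).

Definition component (R : realType) (H : probability (prod_space S) R)
  (i : I) : {RV H >-> S i} := coordinate i.

Context {d' : measure_display} {T : measurableType d'}.

(* The vector of the [X i], all functions of the same random outcome. *)
Definition joint (X : forall i, {mfun T >-> S i}) (t : T) : prod_space S :=
  fun i => X i t.

Lemma measurable_joint (X : forall i, {mfun T >-> S i}) :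
  measurable_fun [set: T] (joint X).
Proof.
apply: (@measurability _ _ T (prod_space S) _ _ (cylinders S)) => //.
move=> _ [_ [i _ [B mB <-]] <-].
rewrite !setTI.
by have := measurable_funPT (X i) measurableT _ mB; rewrite setTI.
Qed.

HB.instance Definition _ (X : forall i, {mfun T >-> S i}) :=
  isMeasurableFun.Build _ _ _ _ (joint X) (@measurable_joint X).

End vectors.

(* Measures are total functions on [set T], so "same distribution" compares
   them on measurable sets only. *)
Definition same_distribution (R : realType) (d : measure_display)
    (T : measurableType d) (P Q : probability T R) : Prop :=
  forall B : set T, measurable B -> P B = Q B.

(* [A phi] is the distribution on [prod_space S] of the vector
   (A^1_phi, ..., A^n_phi), given for the allowable treatments [phi] only. The
   random variable with which the [f k] share their randomness is given by its
   distribution [P]; [f k l] is the random variable f_k(l, .). *)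
Definition selective_influences (R : realType) (n : nat)
    (d : 'I_n -> measure_display) (S : forall k, measurableType (d k))
    (Lambda : 'I_n -> Type) (Phi : set (forall k, Lambda k))
    (A : Phi -> probability (prod_space S) R) : Prop :=
  exists (d' : measure_display) (T : measurableType d') (P : probability T R)
         (f : forall k, Lambda k -> {RV P >-> S k}),
    forall phi : Phi,
      same_distribution (A phi)
        (distribution P (joint (fun k => f k (val phi k)))).

(* Main.v *)
Require Import Defs.
From mathcomp Require Import all_boot all_order all_algebra.
From mathcomp Require Import all_classical all_reals all_analysis.

(* If all A_phi arise from a common R through f_1, ..., f_n, let H consist of all
   the f_k(j, R), one for each value j of each input k. Conversely, take R to be
   H itself and let f_k(j, .) be the projection onto the component H^k_j. *)

Local Open Scope classical_set_scope.
Local Open Scope ring_scope.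

(* Lambda^k is ['I_(m k)]; the vector H has one component, with values in
   [S k], for each pair [Tagged _ j] of an input k and a value j of it. *)
Theorem theorem1p4 (R : realType) (n : nat) (hn : (0 < n)%N)
    (m : 'I_n -> nat) (hm : forall k, (0 < m k)%N)
    (d : 'I_n -> measure_display) (S : forall k, measurableType (d k))
    (Phi : set (forall k, 'I_(m k))) (hPhi : Phi !=set0)
    (A : Phi -> probability (prod_space S) R) :
  selective_influences A <->
  exists H : probability
      (prod_space (fun x : {k : 'I_n & 'I_(m k)} => S (tag x))) R,
    forall phi : Phi,
      same_distribution (A phi)
        (distribution H
           (joint (S := S) (fun k =>
              component H (Tagged (fun k => 'I_(m k)) (val phi k))))).
Proof.
split=> [[d' [T [P [f fE]]]]|[H HE]].
- exists (distribution P
    (joint (fun x : {k : 'I_n & 'I_(m k)} => f (tag x) (tagged x)))).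
  (* Selecting the components named by [phi] from the joint vector gives back
     [joint (fun k => f k (val phi k))], and the pushforward of a pushforward is, by mere unfolding,
     the pushforward along the composite. So [fE] closes the goal up to conversion. *)
  exact: fE.
- exists _, _, H, (fun k j => component H (Tagged (fun k => 'I_(m k)) j)).
  (* With the product space itself as sample space, [f k (val phi k)] reduces to the component of
     [H] that appears in [HE]. *)
  exact: HE.
Qed.
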